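(* For each integer $k\geq 1$ there exists an infinite word $x$ (over some finite alphabet) with factor complexity $p_x(n)=\Omega(n^{k-1})$, with cost $c(x)=0$, and with cost dimension $d_0(x)=k$.
   Context: For a language $L$ (a set of finite words over a finite alphabet), $p_L(n)$ is the number of words of length $n$ in $L$. For an infinite word $x$, $\mathrm{Fac}(x)$ is the set of all finite blocks of consecutive letters of $x$, including the empty word, and $p_x(n)=p_{\mathrm{Fac}(x)}(n)$. $S^k$ denotes the set of all concatenations of $k$ elements of $S$. For real $\alpha\ge 0$, $\mathcal{L}(\alpha)$ is the collection of languages $S$ over some finite nonempty alphabet with $p_S(n)=O(n^\alpha)$. Define $d_\alpha(x)=\inf\{k\ge 1 : \mathrm{Fac}(x)\subseteq S^k \text{ for some } S\in\mathcal{L}(\alpha)\}$ and the cost $c(x)=\inf\{\alpha\in[0,+\infty) : d_\alpha(x)<+\infty\}$, with $\inf\emptyset=+\infty$. If $c=c(x)<+\infty$, the cost dimension of $x$ is $d_c(x)$. Here $f(n)=\Omega(g(n))$ means that there are $K>0$ and $N$ with $f(n)\ge Kg(n)$ for all $n\ge N$. *)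

(* Defs.v *)
From HB Require Import structures.
From mathcomp Require Import all_boot all_order all_algebra.
From mathcomp Require Import all_classical all_reals all_analysis.

Set Implicit Arguments.
Unset Strict Implicit.
Unset Printing Implicit Defensive.

Import Order.TTheory GRing.Theory Num.Theory.
Import numFieldNormedType.Exports.

Local Open Scope classical_set_scope.
Local Open Scope ring_scope.

Definition language (A : finType) := set (seq A).

Definition complexity (A : finType) (L : language A) (n : nat) : nat :=
  #|[pred w : n.-tuple A | `[< L w >]]|.

Definition Fac (A : finType) (x : nat -> A) : language A :=
  [set w | exists i n, w = [seq x j | j <- iota i n]].

Definition language_pow (A : finType) (S : language A) (k : nat) : language A :=
  [set w | exists us : k.-tuple (seq A),
      (forall i, S (tnth us i)) /\ w = flatten us].

Definition growth_class (R : realType) (alpha : R) (A : finType) :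
    set (language A) :=
  [set S | (0 < #|A|)%N /\
    (fun n => (complexity S n)%:R : R) =O_\oo (fun n => n%:R `^ alpha)].

(* The language S may live over a larger alphabet B than that of x; the letters
   of x are then identified with letters of B through the injection f. *)
Definition factorizable (R : realType) (alpha : R) (A : finType) (x : nat -> A)
    (k : nat) : Prop :=
  exists (B : finType) (f : A -> B) (S : language B),
    [/\ injective f, growth_class alpha S &
        [set map f w | w in Fac x] `<=` language_pow S k].

Definition d_alpha (R : realType) (alpha : R) (A : finType) (x : nat -> A) : \bar R :=
  ereal_inf [set (k%:R)%:E | k in
    [set k : nat | (1 <= k)%N /\ factorizable alpha x k]].

Definition cost (R : realType) (A : finType) (x : nat -> A) : \bar R :=
  ereal_inf [set alpha%:E | alpha in
    [set alpha : R | 0 <= alpha /\ (d_alpha alpha x < +oo)%E]].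

(* Only meaningful when [cost R x] is finite, since [fine +oo = 0]. *)
Definition cost_dimension (R : realType) (A : finType) (x : nat -> A) : \bar R :=
  d_alpha (fine (cost R x)) x.

(* Main.v *)
Require Import Defs.
From mathcomp Require Import all_boot all_order all_algebra.
From mathcomp Require Import all_classical all_reals all_analysis.
Import numFieldNormedType.Exports.
Local Open Scope classical_set_scope.
Local Open Scope ring_scope.

Set Implicit Arguments.
Unset Strict Implicit.
Unset Printing Implicit Defensive.

Import Order.TTheory GRing.Theory Num.Theory.

(** Cutting a word of length [n] into [j] consecutive pieces can be done in at
    most [(n + 1) ^ (j - 1)] ways, so a language with at most [C] words of each
    length has a [j]-th power with at most [C ^ j * (n + 1) ^ (j - 1)] words of
    length [n] ([complexity_pow_le]).  Hence a word whose complexity grows at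
    least like [n ^ (k - 1)] satisfies [d_0 >= k]
    ([lt_factorizable_of_complexity]), and the theorem reduces to finding a word
    with that complexity whose factors are products of [k] elements of one
    language of bounded complexity; cost 0 is then automatic.

    For [k = 1] a constant word will do.  For [k = m + 2] take letters
    [a_0, ..., a_m] and a separator [b = a_(m+1)], enumerate the tuples
    [(i_0, ..., i_(m-1))] of naturals, each infinitely often, and build prefixes
    [P_T] of the word by
      [P_(T+1) = P_T a_0^(i_0) ... a_(m-1)^(i_(m-1)) a_m^|P_T| b].

    Complexity: all words [a_m^p b a_0^(i_0) ... a_(m-1)^(i_(m-1)) a_m^q] are
    factors, and there are about [n ^ (m+1)] of them of length [n]
    ([complexity_word_ge]).

    Factorization: a factor ends inside some stage, hence is a suffix of [P_T]
    followed by a factor of [a_0^(i_0) ... a_(m-1)^(i_(m-1)) a_m^|P_T|], which is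
    a product of [m + 1] powers of letters: [m + 2] pieces in all
    ([Fac_word_pieces]).  The suffixes of the [P_T] form a language of bounded
    complexity ([complexity_pieces]) because the run [a_m^|P_T|] is as long as
    all that precedes it: a suffix of length [n] of [P_T'] is [a_m^(n-1) b] as
    soon as some earlier stage has length at least [n], so the only other one is
    that of the first stage that long. *)

(** * Complexity of a language and of its powers *)

Section Complexity.
Local Open Scope nat_scope.

Lemma complexity_le_size (A : finType) (L : language A) n (s : seq (seq A)) :
    (forall w, L w -> size w = n -> w \in s) -> complexity L n <= size s.
Proof.
move=> Ls; rewrite /complexity cardE.
rewrite -(size_map (@tval n A)); apply: uniq_leq_size.
  by rewrite map_inj_uniq ?enum_uniq//; apply: val_inj.
move=> _ /mapP[w + ->]; rewrite mem_enum inE => Lw.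
by apply: Ls => //; exact: size_tuple.
Qed.

Lemma size_le_complexity (A : finType) (L : language A) n (s : seq (seq A)) :
    uniq s -> (forall w, w \in s -> L w /\ size w = n) ->
  size s <= complexity L n.
Proof.
move=> us sL; pose t : seq (n.-tuple A) := pmap insub s.
have <- : size t = size s.
  rewrite size_pmap_sub -[RHS](@count_predT _ s); apply: eq_in_count => w ws.
  by have [_ ->] := sL _ ws; rewrite /= eqxx.
rewrite /complexity cardE; apply: uniq_leq_size; first exact: pmap_sub_uniq.
move=> w; rewrite mem_pmap_sub => /sL[Lw _].
by rewrite mem_enum inE.
Qed.

Lemma complexity_list (A : finType) (L : language A) n :
  exists s : seq (seq A), size s = complexity L n /\
    forall w, L w -> size w = n -> w \in s.
Proof.
exists [seq tval w | w <- enum [pred w : n.-tuple A | `[< L w >]]].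
split; first by rewrite size_map -cardE.
move=> w Lw wn; have wnP : size w == n by apply/eqP.
apply/mapP; exists (Tuple wnP) => //.
by rewrite mem_enum inE.
Qed.

(** A word of the power splits off its first piece, of some length [i <= n];
    each of the [n + 1] values of [i] contributes at most
    [C * (C ^ j * (n + 1) ^ (j - 1))] words. *)
Lemma complexity_pow_le (A : finType) (S : language A) C j :
    (forall n, complexity S n <= C) ->
  forall n, complexity (language_pow S j.+1) n <= C ^ j.+1 * n.+1 ^ j.
Proof.
move=> SC; elim: j => [|j IH] n.
  rewrite expn0 expn1 muln1; have [s [ss sS]] := complexity_list S n.
  apply: leq_trans (SC n); rewrite -ss; apply: complexity_le_size.
  move=> w [us [uS ->]]; case/tupleP: us uS => u us uS.
  rewrite (tuple0 us) /= cats0 => un.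
  by apply: sS => //; have := uS ord0; rewrite tnth0.
pose l i := sval (cid (complexity_list S i)).
pose l' i := sval (cid (complexity_list (language_pow S j.+1) i)).
have lP i : size (l i) = complexity S i /\
  (forall w, S w -> size w = i -> w \in l i) by rewrite /l; case: cid.
have l'P i : size (l' i) = complexity (language_pow S j.+1) i /\
  (forall w, language_pow S j.+1 w -> size w = i -> w \in l' i)
  by rewrite /l'; case: cid.
pose s := flatten [seq [seq u ++ v | u <- l i, v <- l' (n - i)] | i <- iota 0 n.+1].
apply: (@leq_trans (size s)).
  apply: complexity_le_size => w [us [uS ->]]; case/tupleP: us uS => u us uS.
  rewrite /= size_cat => un.
  apply/flattenP; exists [seq u' ++ v | u' <- l (size u), v <- l' (n - size u)].
    by apply/mapP; exists (size u); first by rewrite mem_iota leq0n add0n ltnS -un leq_addr.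
  apply: allpairs_f.
    by apply: (lP _).2 => //; have := uS ord0; rewrite tnth0.
  apply: (l'P _).2; last by rewrite -un addKn.
  exists us; split=> // i; have := uS (lift ord0 i).
  by rewrite tnthS.
rewrite size_flatten sumnE /shape !big_map.
apply: (@leq_trans (\sum_(i <- iota 0 n.+1) C ^ j.+2 * n.+1 ^ j)); last first.
  rewrite big_const_seq count_predT size_iota iter_addn_0.
  by rewrite -mulnA -expnSr.
rewrite !big_seq; apply: leq_sum => i; rewrite mem_iota => /andP[_ ilt].
rewrite size_allpairs (lP i).1 (l'P _).1 expnS -mulnA; apply: leq_mul => //.
apply: leq_trans (IH _) _; rewrite leq_mul2l; apply/orP; right.
by case: (j) => [//|?]; rewrite leq_exp2r// ltnS leq_subr.
Qed.

End Complexity.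

(** * Cost and cost dimension from complexity *)

Section Cost.
Variable R : realType.

(** A bound valid from some rank on extends to all lengths, there being only
    finitely many words of each length. *)
Lemma growth_class0P (A : finType) (S : language A) :
  growth_class (0 : R) S <->
  (0 < #|A|)%N /\ exists C, forall n, (complexity S n <= C)%N.
Proof.
rewrite /growth_class /=; split=> -[A0 SO]; split=> //.
  have /eqO_exP[K K0 [N _ SK]] := SO.
  exists (Num.truncn K + \sum_(i < N) complexity S i)%N => n.
  have [nN|Nn] := ltnP n N.
    by rewrite (bigD1 (Ordinal nN))//= addnCA leq_addr.
  have := SK n Nn; rewrite /= powRr0 normr1 mulr1 ger0_norm// => SnK.
  apply: leq_trans (leq_addr _ _).
  by rewrite truncn_ge_nat// ltW.
have [C SC] := SO.
apply/eqO_exP; exists C.+1%:R; first by rewrite ltr0n.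
near=> n; rewrite /= powRr0 normr1 mulr1 ger0_norm// ler_nat.
exact: leq_trans (SC n) _.
Unshelve. all: by end_near. Qed.

Lemma complexity_injective (A B : finType) (f : A -> B) (L : language A)
    (M : language B) n :
    injective f -> [set map f w | w in L] `<=` M ->
  (complexity L n <= complexity M n)%N.
Proof.
move=> finj LM.
have finjT : injective (fun w : n.-tuple A => map_tuple f w).
  by move=> v w /(congr1 val) /= /(inj_map finj) vw; exact: val_inj.
rewrite /complexity -(fintype.card_image finjT).
apply/subset_leq_card/fintype.subsetP => w /fintype.imageP[v + ->].
by rewrite !inE => Lv; apply: LM; exists v.
Qed.

(** A factorization into [j] pieces bounds [n ^ k] by a multiple of
    [(n + 1) ^ (j - 1)], which forces [k <= j - 1]. *)
Lemma lt_factorizable_of_complexity (A : finType) (x : nat -> A) k D j :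
    (forall n, n ^ k <= D * complexity (Fac x) n)%N ->
    (0 < j)%N -> factorizable (0 : R) x j ->
  (k < j)%N.
Proof.
move=> xD; case: j => // j _ [B [f [S [finj /growth_class0P[_ [C SC]] xS]]]].
rewrite ltnS leqNgt; apply/negP => jk.
(* The factor [2 ^ j] absorbs [n + 2 <= 2 * (n + 1)]. *)
pose E := (D * C ^ j.+1 * 2 ^ j)%N.
have bound n : (n.+1 ^ k <= E * n.+1 ^ j)%N.
  apply: leq_trans (xD _) _; rewrite /E -!mulnA leq_mul2l; apply/orP; right.
  apply: leq_trans (complexity_injective _ finj xS) _.
  apply: leq_trans (complexity_pow_le j SC _) _.
  rewrite leq_mul2l; apply/orP; right; rewrite -expnMn.
  by case: (j) => // i; rewrite leq_exp2r// mul2n -addnn addnS ltnS addSnnS leq_addl.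
(* At [n = E] a single extra factor [n + 1] already outweighs [E]. *)
have := bound E; apply/negP; rewrite -ltnNge.
apply: (@leq_trans (E.+1 ^ j.+1)); first by rewrite expnS ltn_pmul2r// expn_gt0.
exact: leq_pexp2l.
Qed.

Lemma d_alpha_eq (A : finType) (x : nat -> A) k :
    (0 < k)%N -> factorizable (0 : R) x k ->
    (forall j, (0 < j)%N -> factorizable (0 : R) x j -> (k <= j)%N) ->
  d_alpha (0 : R) x = k%:R%:E.
Proof.
move=> k0 xk kmin; apply/le_anti/andP; split.
  by apply: ereal_inf_lbound; exists k.
by apply: le_ereal_inf_tmp => _ [j [j0 xj] <-]; rewrite lee_fin ler_nat kmin.
Qed.

Lemma cost_eq0 (A : finType) (x : nat -> A) :
  (d_alpha (0 : R) x < +oo)%E -> cost R x = 0%E.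
Proof.
move=> x0; apply/le_anti/andP; split.
  by apply: ereal_inf_lbound; exists 0.
by apply: le_ereal_inf_tmp => _ [a [a0 _] <-]; rewrite lee_fin.
Qed.

(** The complexity bound gives the lower bound on [d_0], the factorization the
    upper one; [d_0] being finite, the cost is 0. *)
Lemma cost_of_complexity (A : finType) (x : nat -> A) k D :
    (forall n, n ^ k <= D * complexity (Fac x) n)%N ->
    factorizable (0 : R) x k.+1 ->
  [/\ (fun n : nat => (complexity (Fac x) n)%:R : R)
        \is 'Omega_\oo (fun n : nat => n%:R ^+ k : R),
      cost R x = 0%E &
      cost_dimension R x = k.+1%:R%:E].
Proof.
move=> xD xk.
have d0 : d_alpha (0 : R) x = k.+1%:R%:E.
  by apply: d_alpha_eq => // j; apply: lt_factorizable_of_complexity xD.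
have c0 : cost R x = 0%E by apply: cost_eq0; rewrite d0 ltry.
split=> //; last by rewrite /cost_dimension c0.
rewrite eqOmegaO; apply/eqO_exP; exists D.+1%:R; first by rewrite ltr0n.
near=> n; rewrite /= !ger0_norm// -natrX -natrM ler_nat.
by apply: leq_trans (xD n) _; rewrite leq_mul2r leqnSn orbT.
Unshelve. all: by end_near. Qed.

Lemma factorizable0_pow (A : finType) (x : nat -> A) (S : language A) C j :
    (0 < #|A|)%N -> (forall n, complexity S n <= C)%N ->
    Fac x `<=` language_pow S j ->
  factorizable (0 : R) x j.
Proof.
move=> A0 SC xS; exists A, id, S; split=> //.
  by apply/growth_class0P; split=> //; exists C.
by move=> _ [w xw <-]; rewrite map_id; exact: xS.
Qed.

End Cost.

(** * Products of powers of letters *)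

Section Runs.
Variables (A : eqType) (a : nat -> A).
Local Open Scope nat_scope.

Definition runs (e : nat -> nat) n : seq A :=
  flatten [seq nseq (e j) (a j) | j <- iota 0 n].

Lemma runsS e n : runs e n.+1 = runs e n ++ nseq (e n) (a n).
Proof. by rewrite /runs -addn1 iotaD map_cat flatten_cat /= cats0. Qed.

Lemma eq_runs e e' n : (forall j, j < n -> e j = e' j) -> runs e n = runs e' n.
Proof.
move=> ee'; congr flatten; apply/eq_in_map => j.
by rewrite mem_iota => /andP[_ /ee' ->].
Qed.

Lemma subseq_cat_split (w s t : seq A) : subseq w (s ++ t) ->
  exists u v, [/\ w = u ++ v, subseq u s & subseq v t].
Proof.
case/subseqP => m msz ->.
exists (mask (take (size s) m) s), (mask (drop (size s) m) t).
rewrite !mask_subseq -{1}[m](cat_take_drop (size s)) mask_cat//.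
by rewrite size_takel// msz size_cat leq_addr.
Qed.

(** Taking subsequences, rather than factors, makes the closure property
    compatible with concatenation, so that the number of runs does not grow. *)
Lemma subseq_runs e n w : subseq w (runs e n) -> exists e', w = runs e' n.
Proof.
elim: n w => [|n IH] w.
  by rewrite subseq0 => /eqP ->; exists (fun=> 0).
rewrite runsS => /subseq_cat_split[u [v [-> /IH[e' ->] /mem_subseq vn]]].
exists (fun j => if j == n then size v else e' j).
rewrite runsS eqxx; congr (_ ++ _).
  by apply: eq_runs => j jn; rewrite ltn_eqF.
by apply/all_pred1P/allP => c /vn /nseqP[-> _] /=.
Qed.

Lemma size_runs e n : size (runs e n) = \sum_(j < n) e j.
Proof.
elim: n => [|n IH]; first by rewrite big_ord0.
by rewrite runsS size_cat size_nseq IH big_ord_recr.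
Qed.

Lemma count_runs e n i : {in gtn n.+1 &, injective a} -> i < n ->
  count_mem (a i) (runs e n) = e i.
Proof.
elim: n => // n IH ainj; rewrite ltnS => ilt; rewrite runsS count_cat count_nseq /=.
have ainj' : {in gtn n.+1 &, injective a}.
  by move=> j k; rewrite !inE => jn kn; apply: ainj; rewrite inE /= ltnW.
have [->|ni] := eqVneq i n.
  rewrite eqxx mul1n -[RHS]add0n; congr (_ + _).
  apply/count_memPn/negP => /flatten_mapP[j]; rewrite mem_iota add0n => /andP[_ jn].
  move=> /nseqP[anj _]; have nj : n = j.
    by apply: ainj; rewrite // inE /= ltnS ?leqnSn// leqW// ltnW.
  by move: jn; rewrite -nj ltnn.
rewrite IH// ?ltn_neqAle ?ni//.
have /negbTE -> : a n != a i.
  apply: contra ni => /eqP /ainj; rewrite !inE /= => -> //.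
  by rewrite ltnW.
by rewrite mul0n addn0.
Qed.

Lemma flatten_runs (e : nat -> nat) n :
  flatten [seq nseq (e j) (a j) | j : 'I_n <- enum 'I_n] = runs e n.
Proof. by rewrite /runs -val_enum_ord -map_comp. Qed.

End Runs.

(** * The staged word *)

Lemma drop_size_drop (T : Type) i (s : seq T) :
  drop i s = drop (size s - size (drop i s)) s.
Proof.
have [il|li] := leqP i (size s); first by rewrite size_drop subKn.
by rewrite (drop_oversize (ltnW li)) subn0 drop_size.
Qed.

Lemma unbounded_injection (f : nat -> nat) N :
  injective f -> exists c, (N <= f c)%N.
Proof.
move=> finj; apply: contrapT => /forallNP fN.
have : (size [seq f c | c <- iota 0 N.+1] <= size (iota 0 N))%N.
  apply: uniq_leq_size; first by rewrite map_inj_uniq ?iota_uniq.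
  by move=> _ /mapP[c _ ->]; rewrite mem_iota ltnNge; apply/negP/fN.
by rewrite size_map !size_iota ltnn.
Qed.

Section Word.
Variable m : nat.
Local Open Scope nat_scope.

Definition letter (j : nat) : 'I_m.+2 := inord j.

Lemma letter_inj : {in gtn m.+2 &, injective letter}.
Proof.
move=> i j; rewrite !inE /= => im jm /(congr1 val).
by rewrite /letter /= !inordK.
Qed.

(** Infinitely many lists of naturals begin with a given [m]-tuple, so each tuple
    is met at arbitrarily late stages. *)
Definition exponents (T : nat) : nat -> nat :=
  nth 0 (odflt [::] (unpickle T : option (seq nat))).

Fixpoint stage (T : nat) : seq 'I_m.+2 :=
  if T is T'.+1 then
    stage T' ++ runs letter (exponents T') m
      ++ rcons (nseq (size (stage T')) (letter m)) (letter m.+1)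
  else [::].

(** Each stage prolongs the previous one by at least one letter, so the letter of
    index [i] can be read off stage [i + 1]. *)
Definition word (i : nat) : 'I_m.+2 := nth (letter m.+1) (stage i.+1) i.

Lemma stageS T : stage T.+1 =
  stage T ++ runs letter (exponents T) m
    ++ rcons (nseq (size (stage T)) (letter m)) (letter m.+1).
Proof. by []. Qed.

Lemma stage_cat T d : exists s, stage (T + d) = stage T ++ s.
Proof.
elim: d => [|d [s IH]]; first by exists [::]; rewrite addn0 cats0.
by rewrite addnS stageS {1}IH -catA; eexists.
Qed.

Lemma size_stageS T : size (stage T) < size (stage T.+1).
Proof. by rewrite stageS !size_cat size_rcons !addnS ltnS leq_addr. Qed.

Lemma size_stage_mono T T' : T <= T' -> size (stage T) <= size (stage T').
Proof.
move=> /subnKC <-; have [s ->] := stage_cat T (T' - T).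
by rewrite size_cat leq_addr.
Qed.

Lemma size_stage_ge T : T <= size (stage T).
Proof. by elim: T => // T IH; apply: leq_ltn_trans (size_stageS T). Qed.

Lemma stage_word T : stage T = [seq word i | i <- iota 0 (size (stage T))].
Proof.
apply: (@eq_from_nth _ (letter m.+1)); first by rewrite size_map size_iota.
move=> i iT; rewrite (nth_map 0) ?size_iota// nth_iota// add0n /word.
have [TS|ST] := leqP T i.+1.
  have [s] := stage_cat T (i.+1 - T); rewrite subnKC// => ->.
  by rewrite nth_cat iT.
have [s] := stage_cat i.+1 (T - i.+1); rewrite subnKC 1?ltnW// => ->.
by rewrite nth_cat size_stage_ge.
Qed.

Lemma Fac_word_infix T s w t : stage T = s ++ w ++ t -> Fac word w.
Proof.
move=> E; exists (size s), (size w).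
have := stage_word T; rewrite E !size_cat !iotaD !map_cat => /eqP.
rewrite eqseq_cat ?size_map ?size_iota// => /andP[_].
rewrite eqseq_cat ?size_map ?size_iota// => /andP[/eqP + _].
by rewrite add0n.
Qed.

Lemma stage_suffix T p : p <= size (stage T) -> exists s,
  stage T.+1 = s ++ rcons (nseq p (letter m)) (letter m.+1).
Proof.
move=> pT; rewrite stageS -(subnK pT) nseqD rcons_cat !catA.
by eexists.
Qed.

Lemma drop_stage T p : p <= size (stage T) ->
  drop (size (stage T.+1) - p.+1) (stage T.+1)
    = rcons (nseq p (letter m)) (letter m.+1).
Proof.
case/stage_suffix => s ->; rewrite drop_size_cat//.
by rewrite size_cat size_rcons size_nseq addnK.
Qed.

Definition pieces : language 'I_m.+2 :=
  [set w | (exists j q, j < m.+1 /\ w = nseq q (letter j))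
           \/ exists T i, w = drop i (stage T)].

(** Besides the [m + 1] powers of letters, at most two words of length [n >= 1] are
    suffixes of stages: the suffix of the first stage [T] of length at least
    [n], and [a_m^(n-1) b], which all later stages share. *)
Lemma complexity_pieces n : complexity pieces n <= m.+3.
Proof.
have exT : exists T, n <= size (stage T) by exists n; exact: size_stage_ge.
case: (ex_minnP exT) => T nT Tmin.
pose s := drop (size (stage T) - n) (stage T)
  :: rcons (nseq n.-1 (letter m)) (letter m.+1)
  :: [seq nseq n (letter j) | j <- iota 0 m.+1].
have -> : m.+3 = size s by rewrite /= size_map size_iota.
apply: complexity_le_size => w [[j [q [jm ->]]]|[T' [i ->]]].
  rewrite size_nseq => ->; rewrite 2!in_cons.
  by apply/orP; right; apply/orP; right; apply/mapP; exists j; rewrite ?mem_iota.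
move=> wn; rewrite drop_size_drop wn.
have nT' : n <= size (stage T') by rewrite -wn size_drop leq_subr.
have [TT'|TT'|<-] := ltngtP T T'; last 1 first.
- by rewrite in_cons eqxx.
- case: T' TT' {wn nT'} => // T' TT'; case: n nT @s {Tmin exT} => [|n] nT s.
    by rewrite subn0 drop_size /s subn0 drop_size in_cons eqxx.
  rewrite drop_stage ?in_cons ?eqxx ?orbT//.
  by apply: ltnW; apply: leq_trans nT _; exact: size_stage_mono.
- by have := Tmin _ nT'; rewrite leqNgt TT'.
Qed.

(** Let [T] be the last stage that ends no later than the factor.  The factor
    stops before the end of [stage T.+1], hence before its final separator, so
    what lies beyond [stage T] is inside [m + 1] runs. *)
Lemma Fac_word_stage w : Fac word w -> exists T i e,
  w = drop i (stage T) ++ runs letter e m.+1.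
Proof.
case=> i [n ->].
have exT : exists T, i + n < size (stage T).
  by exists (i + n).+1; exact: size_stage_ge.
case: (ex_minnP exT) => [[//|T] inT Tmin].
have Tin : size (stage T) <= i + n by rewrite leqNgt; apply/negP => /Tmin; rewrite ltnn.
have -> : [seq word j | j <- iota i n] = drop i (take (i + n) (stage T.+1)).
  rewrite stage_word -map_take -map_drop take_iota drop_iota add0n.
  by rewrite (minn_idPl (ltnW inT)) addKn.
rewrite stageS take_cat ltnNge Tin /= drop_cat.
set r := runs _ _ _; set p := size (stage T).
have : subseq (take (i + n - p) (r ++ rcons (nseq p (letter m)) (letter m.+1)))
   (runs letter (fun j => if j == m then p else exponents T j) m.+1).
  rewrite runsS eqxx (@eq_runs _ _ _ (exponents T)); last by move=> j jm; rewrite ltn_eqF.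
  have -> : r ++ rcons (nseq p (letter m)) (letter m.+1) =
     (r ++ nseq p (letter m)) ++ [:: letter m.+1] by rewrite -cats1 catA.
  rewrite takel_cat; first exact: take_subseq.
  move: inT; rewrite stageS !size_cat size_rcons size_nseq -/p -/r.
  by rewrite leq_subLR !addnS ltnS.
move: (take _ _) => t tsub.
case: ifP => _.
  have [e te] := subseq_runs tsub.
  by exists T, i, e; rewrite -te.
have [e te] := subseq_runs (subseq_trans (drop_subseq t (i - p)) tsub).
by exists 0, 0, e.
Qed.

Lemma Fac_word_pieces : Fac word `<=` language_pow pieces m.+2.
Proof.
move=> w /Fac_word_stage[T [i [e ->]]].
exists [tuple of drop i (stage T) ::
  map_tuple (fun j : 'I_m.+1 => nseq (e j) (letter j)) (ord_tuple m.+1)].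
split; last by rewrite /= flatten_runs.
move=> j; case: (unliftP ord0 j) => [j'|] ->.
  by rewrite tnthS tnth_map tnth_ord_tuple; left; exists j', (e j').
by rewrite tnth0; right; exists T, i.
Qed.

(** With [h = (n - 1) / (m + 1)], any exponents [p, i_0, ..., i_(m-1) <= h] give
    a factor [a_m^p b a_0^(i_0) ... a_(m-1)^(i_(m-1)) a_m^q] of length [n] for a
    suitable [q].  The exponents are recovered from the factor as the position of
    [b] and the numbers of letters [a_j], and [n <= (m + 1) * (h + 1)]. *)
Lemma complexity_word_ge n : n ^ m.+1 <= m.+1 ^ m.+1 * complexity (Fac word) n.
Proof.
case: n => [|n]; first by rewrite exp0n.
pose h := n %/ m.+1.
(* The last value of [g] is the exponent [p] before the separator. *)
pose ex (g : {ffun 'I_m.+1 -> 'I_h.+1}) (j : nat) : nat := g (inord j).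
pose q g := n - \sum_(j < m.+1) ex g j.
pose w g := rcons (nseq (ex g m) (letter m)) (letter m.+1)
  ++ runs letter (ex g) m ++ nseq (q g) (letter m).
have exh g j : ex g j <= h by rewrite /ex -ltnS.
have sumn g : \sum_(j < m.+1) ex g j <= n.
  apply: (@leq_trans (\sum_(j < m.+1) h)); first exact: leq_sum.
  by rewrite sum_nat_const card_ord mulnC leq_trunc_div.
have wsize g : size (w g) = n.+1.
  rewrite !size_cat size_rcons !size_nseq size_runs addSn addnA; congr _.+1.
  rewrite [_ + \sum_(j < m) _]addnC.
  have -> : \sum_(j < m) ex g j + ex g m = \sum_(j < m.+1) ex g j.
    by rewrite big_ord_recr.
  by rewrite subnKC.
have wFac g : Fac word (w g).
  pose s c := rcons [seq ex g j | j <- iota 0 m] c.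
  (* The extra entry [c] moves the occurrence to a stage late enough for the
     neighbouring runs of [a_m] to contain [a_m^p] and [a_m^q]. *)
  have [c cn] : exists c, n.+2 <= pickle (s c).
    apply: unbounded_injection => c c' /(pcan_inj pickleK).
    by move=> /rcons_inj[].
  move: (pickle (s c)) (pickleK (s c)) cn => [//|T] sT nT.
  have [u Eu] : exists u, stage T.+1 = u ++ rcons (nseq (ex g m) (letter m)) (letter m.+1).
    apply: stage_suffix; apply: leq_trans (size_stage_ge T).
    by rewrite (leq_trans (exh _ _))// (leq_trans (leq_div _ _))// ltnW.
  have qn : q g <= size (stage T.+1).
    by apply: leq_trans (size_stage_ge _); rewrite (leq_trans (leq_subr _ _))// ltnW// ltnW.
  apply: (@Fac_word_infix T.+2 u (w g)
    (rcons (nseq (size (stage T.+1) - q g) (letter m)) (letter m.+1))).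
  rewrite stageS -[X in rcons (nseq X _) _](subnKC qn) nseqD rcons_cat {1}Eu /w.
  rewrite -!catA -(@eq_runs _ _ (ex g)); last first.
    move=> j jm; rewrite /exponents sT /= nth_rcons size_map size_iota jm.
    by rewrite (nth_map 0) ?size_iota// nth_iota.
  by [].
have winj : injective w.
  have linj : {in gtn m.+2 &, injective letter} := letter_inj.
  move=> g g' gg'; apply/ffunP => j; apply: val_inj.
  suff : ex g j = ex g' j by rewrite /ex inord_val.
  have [jm|] := ltnP j m; last first.
    move=> mj; have -> : j = m :> nat by apply/eqP; rewrite eqn_leq -ltnS ltn_ord.
    have indexw g1 : index (letter m.+1) (w g1) = ex g1 m.
      rewrite /w cat_rcons index_cat ifF; first by rewrite size_nseq /= eqxx addn0.
      apply/negP => /nseqP[/linj]; rewrite !inE /= => /(_ (ltnSn _) (leqnSn _)).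
      by move/eqP; rewrite gtn_eqF.
    by rewrite -!indexw gg'.
  have countw g1 : count_mem (letter j) (w g1) = ex g1 j.
    have mj : letter m != letter j.
      apply/eqP => /linj; rewrite !inE /= => /(_ (leqnSn _) (leqW (ltn_ord j))) E.
      by move: jm; rewrite -E ltnn.
    have sj : letter m.+1 != letter j.
      apply/eqP => /linj; rewrite !inE /= => /(_ (ltnSn _) (leqW (ltn_ord j))) E.
      by move: (ltn_ord j); rewrite -E ltnn.
    rewrite /w -cats1 !count_cat !count_nseq /= (negbTE mj) (negbTE sj) !mul0n.
    rewrite !addn0 add0n count_runs//.
    by move=> i k; rewrite !inE => im km; apply: linj; rewrite inE ltnW.
  by rewrite -!countw gg'.
have hcount : h.+1 ^ m.+1 <= complexity (Fac word) n.+1.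
  have -> : h.+1 ^ m.+1 = size [seq w g | g <- enum {ffun 'I_m.+1 -> 'I_h.+1}].
    by rewrite size_map -cardE card_ffun !card_ord.
  apply: size_le_complexity; first by rewrite map_inj_uniq ?enum_uniq.
  by move=> _ /mapP[g _ ->].
apply: leq_trans (leq_mul (leqnn _) hcount).
rewrite -expnMn leq_exp2r// mulnC -/h.
exact: ltn_ceil.
Qed.

End Word.

(** * The theorem *)

Lemma size_unit_seq (w : seq unit) : w = nseq (size w) tt.
Proof. by elim: w => //= -[] w {1}->. Qed.

Lemma complexity_constant n : complexity (Fac (fun=> tt)) n = 1%N.
Proof.
apply/eqP; rewrite eqn_leq; apply/andP; split.
  apply: (@complexity_le_size _ _ _ [:: nseq n tt]) => w _ <-.
  by rewrite -size_unit_seq mem_head.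
apply: (@size_le_complexity _ _ _ [:: nseq n tt]) => // w.
rewrite inE => /eqP ->; rewrite size_nseq; split=> //; exists 0%N, n.
by rewrite [RHS]size_unit_seq size_map size_iota.
Qed.

Theorem proposition3p11 (R : realType) (k : nat) (hk : (1 <= k)%N) :
  exists (A : finType) (x : nat -> A),
    [/\ (fun n : nat => (complexity (Fac x) n)%:R : R)
          \is 'Omega_\oo (fun n : nat => n%:R ^+ (k - 1) : R),
        cost R x = 0%E &
        cost_dimension R x = k%:R%:E].
Proof.
case: k hk => [//|[|m]] _; rewrite subn1 /=.
  exists unit, (fun=> tt); apply: (@cost_of_complexity _ _ _ 0 1) => [n|].
    by rewrite complexity_constant expn0.
  apply: (@factorizable0_pow R _ _ (Fac (fun=> tt)) 1).
  - by rewrite card_unit.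
  - by move=> n; rewrite complexity_constant.
  - by move=> w xw; exists [tuple w]; rewrite /= cats0; split=> // i; rewrite ord1 tnth0.
exists 'I_m.+2, (word m).
apply: (cost_of_complexity (@complexity_word_ge m)).
apply: (@factorizable0_pow R _ _ (@pieces m) m.+3).
- by rewrite card_ord.
- exact: complexity_pieces.
- exact: Fac_word_pieces.
Qed.
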